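(* Let $Q$ be an $n$-dimensional manifold with a rank-$m$ nonholonomic constraint distribution $\mathcal D$, constraint submanifold $\mathcal C\subset TQ$, and an adapted frame $\{X_i\}=\{X_\alpha,X_a\}$ with quasi-velocities $v^i$. Let $L$ be a regular Lagrangian on $TQ$ which is regular with respect to both $\mathcal D$ and $\mathcal D^\perp$, and let $\Gamma$ be its nonholonomic dynamical vector field, with multipliers $\lambda_a$. The necessary and sufficient condition for the nonholonomic and vakonomic problems to be strongly consistent is the existence of a section $\phi$ of the projection $\mathcal C\times\mathbb R^{n-m}\to\mathcal C$ such that on $\mathcal C$ $$\phi_aR^a_{\alpha\beta}v^\beta=0\quad(\alpha=1,\dots,m)\qquad\text{and}\qquad \Gamma(\phi_a)+\phi_bR^b_{a\alpha}v^\alpha=\lambda_a\quad(a=m+1,\dots,n).$$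
   Context: All considerations are local: $Q$ may be taken to be the domain of the frame. Summation convention. $\tau:TQ\to Q$; local coordinates $q^i$ on $Q$, fibre coordinates $u^i$ on $TQ$. For a vector field $Z=Z^i\,\partial/\partial q^i$ on $Q$: complete lift $Z^{\mathrm C}=Z^i\frac{\partial}{\partial q^i}+u^j\frac{\partial Z^i}{\partial q^j}\frac{\partial}{\partial u^i}$, vertical lift $Z^{\mathrm V}=Z^i\frac{\partial}{\partial u^i}$. $\mathcal D$ is a non-integrable smooth distribution on $Q$ of constant rank $m$, and $\mathcal C=\{(q,u)\in TQ:u\in\mathcal D_q\}$. An adapted frame is a frame $\{X_i\}$, $i=1,\dots,n$, on $Q$ whose first $m$ members $\{X_\alpha\}$, $\alpha=1,\dots,m$, span $\mathcal D$; the others are $\{X_a\}$, $a=m+1,\dots,n$. Its dual coframe is $\{\theta^i\}$; the quasi-velocities are the functions $v^i(q,u)=\theta^i_q(u)$ on $TQ$, so $\mathcal C$ is given by $v^a=0$. The functions $R^k_{ij}$ are defined by $[X_i,X_j]=R^k_{ij}X_k$. Let $g_{ij}=X_i^{\mathrm V}(X_j^{\mathrm V}(L))$. $L$ is regular if $(g_{ij})$ is nonsingular; regular with respect to $\mathcal D$ if $(g_{\alpha\beta})$ is nonsingular on $\mathcal C$; and then, with $(g^{\alpha\beta})$ the inverse of $(g_{\alpha\beta})$, regular with respect to $\mathcal D^\perp$ if $(g_{ab}-g^{\alpha\beta}g_{a\alpha}g_{b\beta})$ is nonsingular on $\mathcal C$. Nonholonomic dynamics: $\Gamma$ is the unique vector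 field on $\mathcal C$ which is of second-order type ($\tau_{*(q,u)}\Gamma=u$ on $\mathcal C$), tangent to $\mathcal C$, and satisfies $\Gamma(X_\alpha^{\mathrm V}(L))-X_\alpha^{\mathrm C}(L)=0$ on $\mathcal C$ for $\alpha=1,\dots,m$. Its multipliers are the functions $\lambda_a=\Gamma(X_a^{\mathrm V}(L))-X_a^{\mathrm C}(L)$ on $\mathcal C$. Vakonomic problem: on $TQ\times\mathbb R^{n-m}$ (coordinates $\mu_a$ on $\mathbb R^{n-m}$) let $\hat\omega=d\big(X_i^{\mathrm V}(L)\theta^i-\mu_a\theta^a\big)$ and $E=v^iX_i^{\mathrm V}(L)-L$ (pullbacks not indicated). The vakonomic equations for a vector field $\hat\Gamma$ are $\hat\Gamma\lrcorner\hat\omega=-dE$; solutions exist only at points of $\mathcal C\times\mathbb R^{n-m}$. A section $\phi$ is given by functions $\phi_a$ on $\mathcal C$; $\operatorname{im}(\phi)=\{(w,\mu):w\in\mathcal C,\ \mu_a=\phi_a(w)\}$. A vector field on $\operatorname{im}(\phi)$ assigns to each of its points a tangent vector to $TQ\times\mathbb R^{n-m}$ there, not necessarily tangent to $\operatorname{im}(\phi)$. Under the regularity assumptions, for each section $\phi$ there is a unique vector field $\hat\Gamma$ on $\operatorname{im}(\phi)$ which satisfies the vakonomic equations there and whose $TQ$-component $\Gamma_{\mathcal C}$ (regarded as a field of tangent vectors to $TQ$ at points of $\mathcal C$) is tangent to $\mathcal C$. The problems are weakly consistent on $\operatorname{im}(\phi)$ if this $\Gamma_{\mathcal C}$ equals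 $\Gamma$; in that case the vakonomic field $\hat\Gamma$ is $\bar\Gamma=\Gamma+(\lambda_a-\phi_bR^b_{a\alpha}v^\alpha)\,\partial/\partial\mu_a$. The nonholonomic and vakonomic problems are strongly consistent if for some section $\phi$ they are weakly consistent on $\operatorname{im}(\phi)$ and in addition the vakonomic field $\bar\Gamma$ is tangent to $\operatorname{im}(\phi)$ (in other words, $\phi_*\Gamma$ satisfies the vakonomic equations on $\operatorname{im}(\phi)$). *)

(* Defs.v *)
From HB Require Import structures.
From mathcomp Require Export all_boot all_order all_algebra.
From mathcomp Require Export all_classical all_reals all_analysis.
Export Order.TTheory GRing.Theory Num.Theory numFieldNormedType.Exports.

#[export] Set Implicit Arguments.
#[export] Unset Strict Implicit.
#[export] Unset Printing Implicit Defensive.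

Local Open Scope classical_set_scope.
Local Open Scope ring_scope.

(* Meant for U open; on finite-dimensional spaces this is the usual C^r. *)
Fixpoint Cr (R : realType) (V W : normedModType R) (r : nat) (U : set V)
    (f : V -> W) {struct r} : Prop :=
  match r with
  | 0 => forall x, U x -> {for x, continuous f}
  | r'.+1 => (forall x, U x -> differentiable f x) /\
             forall v : V, Cr r' U (fun x => 'D_v f x)
  end.

Definition smooth (R : realType) (V W : normedModType R) (U : set V)
    (f : V -> W) : Prop :=
  forall r, Cr r U f.

Definition smooth_extension_near (R : realType) (V W : normedModType R)
    (S : set V) (f : V -> W) (x : V) (F : V -> W) : Prop :=
  exists O : set V, [/\ open O, O x, smooth O F &
                        forall y, O y -> S y -> F y = f y].

(* Smoothness of f as a function on the subset S: the values of f outside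
   S are irrelevant. *)
Definition smooth_on_subset (R : realType) (V W : normedModType R)
    (S : set V) (f : V -> W) : Prop :=
  forall x, S x -> exists F, smooth_extension_near S f x F.

(* xi is tangent to S at x: it is the velocity of a curve lying in S.  For an
   embedded submanifold these are exactly the elements of T_x S. *)
Definition tangent_to (R : realType) (V : normedModType R) (S : set V)
    (x xi : V) : Prop :=
  exists c : R -> V, [/\ c 0 = x, (\forall t \near (0 : R), S (c t)) &
                         is_derive (0 : R) (1 : R) c xi].

(* The derivative xi(f) of a smooth function f on a submanifold S along a
   vector xi tangent to S at x, computed with an arbitrary local smooth
   extension of f; as xi is tangent to S, the result does not depend on the
   extension. *)
Definition derive_along (R : realType) (V W : normedModType R) (S : set V)
    (f : V -> W) (x xi : V) : W :=
  get [set l | exists F, smooth_extension_near S f x F /\ l = 'D_xi F x].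

(* Here Q is an open subset of R^n.  TQ = Q x R^n has coordinates (q, u); a tangent vector to TQ is a pair
   (dq, du).  A vector field is given by its components, as a function into
   the ambient vector space. *)

Definition tangent_bundle (R : realType) (n : nat) (Q : set 'rV[R]_n) :
    set ('rV[R]_n * 'rV[R]_n) :=
  [set w | Q w.1].

Definition lie_bracket (R : realType) (n : nat) (Y Z : 'rV[R]_n -> 'rV[R]_n)
    (q : 'rV[R]_n) : 'rV[R]_n :=
  'D_(Y q) Z q - 'D_(Z q) Y q.

(* The fibre component of the complete lift is u^j dZ^i/dq^j. *)
Definition complete_lift (R : realType) (n : nat) (Z : 'rV[R]_n -> 'rV[R]_n)
    (w : 'rV[R]_n * 'rV[R]_n) : 'rV[R]_n * 'rV[R]_n :=
  (Z w.1, 'D_(w.2) Z w.1).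

Definition vertical_lift (R : realType) (n : nat) (Z : 'rV[R]_n -> 'rV[R]_n)
    (w : 'rV[R]_n * 'rV[R]_n) : 'rV[R]_n * 'rV[R]_n :=
  (0, Z w.1).

Definition lie_derive (R : realType) (V : normedModType R) (Z : V -> V)
    (f : V -> R) (x : V) : R :=
  'D_(Z x) f x.

(* dvartheta(xi, eta) for a one-form vartheta on an open subset of V, where
   vartheta x eta is the value at x on the vector eta:
   xi(vartheta(eta)) - eta(vartheta(xi)) - vartheta([xi, eta]) with xi and eta
   extended to constant, hence commuting, vector fields. *)
Definition ext_derive (R : realType) (V : normedModType R)
    (vartheta : V -> V -> R) (x xi eta : V) : R :=
  'D_xi (vartheta^~ eta) x - 'D_eta (vartheta^~ xi) x.

(* Through every point of Q there passes an integral manifold of the rank m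
   distribution D, given by a local parametrization psi.  When D has rank m,
   psi is automatically an immersion. *)
Definition integrable_distribution (R : realType) (n m : nat)
    (Q : set 'rV[R]_n) (D : 'rV[R]_n -> {vspace 'rV[R]_n}) : Prop :=
  forall q, Q q ->
  exists (V : set 'rV[R]_m) (psi : 'rV[R]_m -> 'rV[R]_n) (s0 : 'rV[R]_m),
    [/\ open V, V s0, smooth V psi, psi s0 = q &
        forall s, V s -> Q (psi s) /\
          forall u : 'rV[R]_n,
            u \in D (psi s) <-> exists ds : 'rV[R]_m, 'D_ds psi s = u].

(* n = m + k; the frame indices alpha = 1..m are [lshift k alpha], the indices
   a = m+1..n are [rshift m a].  Row i of this matrix is X_i(q). *)
Definition frame_mx (R : realType) (n : nat)
    (X : 'I_n -> 'rV[R]_n -> 'rV[R]_n) (q : 'rV[R]_n) : 'M[R]_n :=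
  \matrix_(i, j) X i q 0 j.

Definition adapted_frame (R : realType) (m k : nat) (Q : set 'rV[R]_(m + k))
    (D : 'rV[R]_(m + k) -> {vspace 'rV[R]_(m + k)})
    (X : 'I_(m + k) -> 'rV[R]_(m + k) -> 'rV[R]_(m + k)) : Prop :=
  [/\ forall i, smooth Q (X i),
      forall q, Q q -> frame_mx X q \in unitmx &
      forall q, Q q -> D q = <<[seq X (lshift k al) q | al : 'I_m]>>%VS].

(* theta^i_q(u), determined by u = sum_i theta^i_q(u) X_i(q). *)
Definition coframe (R : realType) (n : nat)
    (X : 'I_n -> 'rV[R]_n -> 'rV[R]_n) (i : 'I_n) (q u : 'rV[R]_n) : R :=
  (u *m invmx (frame_mx X q)) 0 i.

Definition quasi_velocity (R : realType) (n : nat)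
    (X : 'I_n -> 'rV[R]_n -> 'rV[R]_n) (i : 'I_n)
    (w : 'rV[R]_n * 'rV[R]_n) : R :=
  coframe X i w.1 w.2.

(* [frame_coef X l i j] is R^l_{ij}. *)
Definition frame_coef (R : realType) (n : nat)
    (X : 'I_n -> 'rV[R]_n -> 'rV[R]_n) (l i j : 'I_n) (q : 'rV[R]_n) : R :=
  coframe X l q (lie_bracket (X i) (X j) q).

Definition constraint_set (R : realType) (n : nat) (Q : set 'rV[R]_n)
    (D : 'rV[R]_n -> {vspace 'rV[R]_n}) : set ('rV[R]_n * 'rV[R]_n) :=
  [set w | Q w.1 /\ w.2 \in D w.1].

(* X_i^V(L) *)
Definition momentum (R : realType) (n : nat)
    (X : 'I_n -> 'rV[R]_n -> 'rV[R]_n) (L : 'rV[R]_n * 'rV[R]_n -> R)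
    (i : 'I_n) : 'rV[R]_n * 'rV[R]_n -> R :=
  lie_derive (vertical_lift (X i)) L.

Definition hess_coef (R : realType) (n : nat)
    (X : 'I_n -> 'rV[R]_n -> 'rV[R]_n) (L : 'rV[R]_n * 'rV[R]_n -> R)
    (i j : 'I_n) : 'rV[R]_n * 'rV[R]_n -> R :=
  lie_derive (vertical_lift (X i)) (momentum X L j).

Definition hess_mx (R : realType) (n : nat)
    (X : 'I_n -> 'rV[R]_n -> 'rV[R]_n) (L : 'rV[R]_n * 'rV[R]_n -> R)
    (w : 'rV[R]_n * 'rV[R]_n) : 'M[R]_n :=
  \matrix_(i, j) hess_coef X L i j w.

Definition hessD_mx (R : realType) (m k : nat)
    (X : 'I_(m + k) -> 'rV[R]_(m + k) -> 'rV[R]_(m + k))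
    (L : 'rV[R]_(m + k) * 'rV[R]_(m + k) -> R)
    (w : 'rV[R]_(m + k) * 'rV[R]_(m + k)) : 'M[R]_m :=
  \matrix_(al, be) hess_coef X L (lshift k al) (lshift k be) w.

Definition hessDperp_mx (R : realType) (m k : nat)
    (X : 'I_(m + k) -> 'rV[R]_(m + k) -> 'rV[R]_(m + k))
    (L : 'rV[R]_(m + k) * 'rV[R]_(m + k) -> R)
    (w : 'rV[R]_(m + k) * 'rV[R]_(m + k)) : 'M[R]_k :=
  \matrix_(a, b)
    (hess_coef X L (rshift m a) (rshift m b) w
     - \sum_(al < m) \sum_(be < m)
         invmx (hessD_mx X L w) al be
         * hess_coef X L (rshift m a) (lshift k al) w
         * hess_coef X L (rshift m b) (lshift k be) w).

Definition regular_lagrangian (R : realType) (n : nat) (Q : set 'rV[R]_n)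
    (X : 'I_n -> 'rV[R]_n -> 'rV[R]_n) (L : 'rV[R]_n * 'rV[R]_n -> R) : Prop :=
  forall w, tangent_bundle Q w -> hess_mx X L w \in unitmx.

Definition regular_wrt_D (R : realType) (m k : nat) (Q : set 'rV[R]_(m + k))
    (D : 'rV[R]_(m + k) -> {vspace 'rV[R]_(m + k)})
    (X : 'I_(m + k) -> 'rV[R]_(m + k) -> 'rV[R]_(m + k))
    (L : 'rV[R]_(m + k) * 'rV[R]_(m + k) -> R) : Prop :=
  forall w, constraint_set Q D w -> hessD_mx X L w \in unitmx.

Definition regular_wrt_Dperp (R : realType) (m k : nat)
    (Q : set 'rV[R]_(m + k))
    (D : 'rV[R]_(m + k) -> {vspace 'rV[R]_(m + k)})
    (X : 'I_(m + k) -> 'rV[R]_(m + k) -> 'rV[R]_(m + k))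
    (L : 'rV[R]_(m + k) * 'rV[R]_(m + k) -> R) : Prop :=
  forall w, constraint_set Q D w -> hessDperp_mx X L w \in unitmx.

(* Gamma(X_i^V(L)) - X_i^C(L) *)
Definition euler_lagrange (R : realType) (n : nat)
    (X : 'I_n -> 'rV[R]_n -> 'rV[R]_n) (L : 'rV[R]_n * 'rV[R]_n -> R)
    (Gamma : 'rV[R]_n * 'rV[R]_n -> 'rV[R]_n * 'rV[R]_n) (i : 'I_n)
    (w : 'rV[R]_n * 'rV[R]_n) : R :=
  lie_derive Gamma (momentum X L i) w - lie_derive (complete_lift (X i)) L w.

(* A field of tangent vectors to TQ along C, so only the values on C matter.
   The first component of Gamma w is the image of Gamma w under the
   differential of the projection TQ -> Q. *)
Definition nonholonomic_dynamics (R : realType) (m k : nat)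
    (Q : set 'rV[R]_(m + k))
    (D : 'rV[R]_(m + k) -> {vspace 'rV[R]_(m + k)})
    (X : 'I_(m + k) -> 'rV[R]_(m + k) -> 'rV[R]_(m + k))
    (L : 'rV[R]_(m + k) * 'rV[R]_(m + k) -> R)
    (Gamma : 'rV[R]_(m + k) * 'rV[R]_(m + k) ->
             'rV[R]_(m + k) * 'rV[R]_(m + k)) : Prop :=
  forall w, constraint_set Q D w ->
    [/\ (Gamma w).1 = w.2,
        tangent_to (constraint_set Q D) w (Gamma w) &
        forall al : 'I_m, euler_lagrange X L Gamma (lshift k al) w = 0].

Definition multiplier (R : realType) (m k : nat)
    (X : 'I_(m + k) -> 'rV[R]_(m + k) -> 'rV[R]_(m + k))
    (L : 'rV[R]_(m + k) * 'rV[R]_(m + k) -> R)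
    (Gamma : 'rV[R]_(m + k) * 'rV[R]_(m + k) ->
             'rV[R]_(m + k) * 'rV[R]_(m + k))
    (a : 'I_k) (w : 'rV[R]_(m + k) * 'rV[R]_(m + k)) : R :=
  euler_lagrange X L Gamma (rshift m a) w.

Definition energy (R : realType) (n : nat)
    (X : 'I_n -> 'rV[R]_n -> 'rV[R]_n) (L : 'rV[R]_n * 'rV[R]_n -> R)
    (w : 'rV[R]_n * 'rV[R]_n) : R :=
  \sum_(i < n) quasi_velocity X i w * momentum X L i w - L w.

(* The one-form X_i^V(L) theta^i - mu_a theta^a; theta^i is pulled back from
   Q, so it only sees the dq component eta.1.1 of the vector eta. *)
Definition vakonomic_form (R : realType) (m k : nat)
    (X : 'I_(m + k) -> 'rV[R]_(m + k) -> 'rV[R]_(m + k))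
    (L : 'rV[R]_(m + k) * 'rV[R]_(m + k) -> R)
    (p eta : 'rV[R]_(m + k) * 'rV[R]_(m + k) * 'rV[R]_k) : R :=
  \sum_(i < m + k) momentum X L i p.1 * coframe X i p.1.1 eta.1.1
  - \sum_(a < k) p.2 0 a * coframe X (rshift m a) p.1.1 eta.1.1.

(* The interior product of xi with the exterior derivative of the form above
   equals - dE at p. *)
Definition vakonomic_eq (R : realType) (m k : nat)
    (X : 'I_(m + k) -> 'rV[R]_(m + k) -> 'rV[R]_(m + k))
    (L : 'rV[R]_(m + k) * 'rV[R]_(m + k) -> R)
    (p xi : 'rV[R]_(m + k) * 'rV[R]_(m + k) * 'rV[R]_k) : Prop :=
  forall eta : 'rV[R]_(m + k) * 'rV[R]_(m + k) * 'rV[R]_k,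
    ext_derive (vakonomic_form X L) p xi eta
    = - 'D_eta (fun p' => energy X L p'.1) p.

Definition section_image (R : realType) (m k : nat)
    (Q : set 'rV[R]_(m + k))
    (D : 'rV[R]_(m + k) -> {vspace 'rV[R]_(m + k)})
    (phi : 'rV[R]_(m + k) * 'rV[R]_(m + k) -> 'rV[R]_k) :
    set ('rV[R]_(m + k) * 'rV[R]_(m + k) * 'rV[R]_k) :=
  [set p | constraint_set Q D p.1 /\ p.2 = phi p.1].

(* hGamma is the vakonomic field on im(phi): a field of tangent vectors to
   TQ x R^k at points of im(phi), not assumed tangent to im(phi).  Only its
   values on im(phi) matter, and there it is unique under the three regularity
   assumptions on L. *)
Definition vakonomic_field (R : realType) (m k : nat)
    (Q : set 'rV[R]_(m + k))
    (D : 'rV[R]_(m + k) -> {vspace 'rV[R]_(m + k)})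
    (X : 'I_(m + k) -> 'rV[R]_(m + k) -> 'rV[R]_(m + k))
    (L : 'rV[R]_(m + k) * 'rV[R]_(m + k) -> R)
    (phi : 'rV[R]_(m + k) * 'rV[R]_(m + k) -> 'rV[R]_k)
    (hGamma : 'rV[R]_(m + k) * 'rV[R]_(m + k) * 'rV[R]_k ->
              'rV[R]_(m + k) * 'rV[R]_(m + k) * 'rV[R]_k) : Prop :=
  forall p, section_image Q D phi p ->
    vakonomic_eq X L p (hGamma p) /\
    tangent_to (constraint_set Q D) p.1 (hGamma p).1.

(* The problems are weakly consistent on im(phi), hGamma being the vakonomic
   field there. *)
Definition weakly_consistent_via (R : realType) (m k : nat)
    (Q : set 'rV[R]_(m + k))
    (D : 'rV[R]_(m + k) -> {vspace 'rV[R]_(m + k)})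
    (X : 'I_(m + k) -> 'rV[R]_(m + k) -> 'rV[R]_(m + k))
    (L : 'rV[R]_(m + k) * 'rV[R]_(m + k) -> R)
    (Gamma : 'rV[R]_(m + k) * 'rV[R]_(m + k) ->
             'rV[R]_(m + k) * 'rV[R]_(m + k))
    (phi : 'rV[R]_(m + k) * 'rV[R]_(m + k) -> 'rV[R]_k)
    (hGamma : 'rV[R]_(m + k) * 'rV[R]_(m + k) * 'rV[R]_k ->
              'rV[R]_(m + k) * 'rV[R]_(m + k) * 'rV[R]_k) : Prop :=
  vakonomic_field Q D X L phi hGamma /\
  forall p, section_image Q D phi p -> (hGamma p).1 = Gamma p.1.

Definition strongly_consistent (R : realType) (m k : nat)
    (Q : set 'rV[R]_(m + k))
    (D : 'rV[R]_(m + k) -> {vspace 'rV[R]_(m + k)})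
    (X : 'I_(m + k) -> 'rV[R]_(m + k) -> 'rV[R]_(m + k))
    (L : 'rV[R]_(m + k) * 'rV[R]_(m + k) -> R)
    (Gamma : 'rV[R]_(m + k) * 'rV[R]_(m + k) ->
             'rV[R]_(m + k) * 'rV[R]_(m + k)) : Prop :=
  exists phi hGamma,
    [/\ smooth_on_subset (constraint_set Q D) phi,
        weakly_consistent_via Q D X L Gamma phi hGamma &
        forall p, section_image Q D phi p ->
          tangent_to (section_image Q D phi) p (hGamma p)].

(* Main.v *)
(* At a point (w, mu) with w = (q, u) in C, let xi be a vector whose TQ-component
   projects to u.  By the duality of frame and coframe and Cartan's formula for
   d theta^i, the vakonomic one-form xi _| omega + dE annihilates all directions
   except the dq ones, and its value on X_j is
     xi(X_j^V L) - X_j^C L - xi(mu_j) - mu_b R^b_{j alpha} v^alpha,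
   with mu_j = 0 for j <= m.  If xi projects to Gamma w, the components j <= m
   reduce to the algebraic condition on phi, and the others prescribe the
   mu-velocity of xi as lambda_a - phi_b R^b_{a alpha} v^alpha; tangency of xi to
   im(phi) says that this velocity is Gamma(phi_a). *)
Require Import Defs.
From mathcomp Require Import ring.
Local Open Scope classical_set_scope.
Local Open Scope ring_scope.

(** * Derivatives and differentiability *)

Section calculus.
Context {R : realType}.
Implicit Types U V W : normedModType R.

(** A first-order expansion sees only the germ at [x], so ['d f x] also serves as the differential
    of [g]. *)
Lemma near_eq_differentiable V W (f g : V -> W) (x : V) :
  {near x, f =1 g} -> differentiable f x -> differentiable g x.
Proof.
move=> fg df; have fgx : f x = g x by exact: nbhs_singleton fg.
have dfc : continuous ('d f x) by exact: diff_continuous.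
have eqg : g \o shift x = cst (g x) + 'd f x +o_ 0 id.
  apply/eqaddoP => e e0; have /eqaddoP/(_ e e0) := diff_locally df.
  have fg0 : \forall h \near 0, f (h + x) = g (h + x).
    by move: fg; rewrite (near_shift 0) subr0.
  by apply: filterS2 fg0 => h fgh; rewrite !fctE /= fgx fgh.
apply/diff_locallyP; rewrite (diff_unique dfc eqg); split => //.
Qed.

Lemma derive_comp U V W (f : U -> V) (g : V -> W) (x v : U) :
  differentiable f x -> differentiable g (f x) ->
  'D_v (g \o f) x = 'D_('D_v f x) g (f x).
Proof.
move=> df dg; have dgf := differentiable_comp df dg.
by rewrite (deriveE _ dgf) (deriveE _ df) (deriveE _ dg) (diff_comp df dg).
Qed.

Lemma derive_linear V W (f : {linear V -> W}) (x v : V) :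
  continuous f -> 'D_v f x = f v.
Proof.
by move=> cf; rewrite (deriveE _ (linear_differentiable x cf)) diff_lin.
Qed.

Lemma deriveDv V W (f : V -> W) (x u v : V) :
  differentiable f x -> 'D_(u + v) f x = 'D_u f x + 'D_v f x.
Proof. by move=> df; rewrite !(deriveE _ df) linearD. Qed.

Lemma deriveZv V W (f : V -> W) (x v : V) (a : R) :
  differentiable f x -> 'D_(a *: v) f x = a *: 'D_v f x.
Proof. by move=> df; rewrite !(deriveE _ df) linearZ. Qed.

Lemma derive_sumv V W (f : V -> W) (x : V) (I : finType) (v : I -> V) :
  differentiable f x -> 'D_(\sum_i v i) f x = \sum_i 'D_(v i) f x.
Proof.
move=> df; rewrite (deriveE _ df) linear_sum; apply: eq_bigr => i _.
by rewrite (deriveE _ df).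
Qed.

Lemma differentiable_fst U V (p : U * V) : differentiable (@fst U V) p.
Proof. by apply: (@linear_differentiable _ _ _ fst) => x; exact: cvg_fst. Qed.

Lemma differentiable_snd U V (p : U * V) : differentiable (@snd U V) p.
Proof. by apply: (@linear_differentiable _ _ _ snd) => x; exact: cvg_snd. Qed.

Lemma derive_fst U V (p v : U * V) : 'D_v (@fst U V) p = v.1.
Proof. by apply: (@derive_linear _ _ fst) => x; exact: cvg_fst. Qed.

Lemma derive_snd U V (p v : U * V) : 'D_v (@snd U V) p = v.2.
Proof. by apply: (@derive_linear _ _ snd) => x; exact: cvg_snd. Qed.

Lemma derive_comp_fst U V W (f : U -> W) (p v : U * V) :
  differentiable f p.1 -> 'D_v (fun y => f y.1) p = 'D_(v.1) f p.1.
Proof.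
by move=> df; rewrite (derive_comp _ (differentiable_fst p) df) derive_fst.
Qed.

Lemma differentiable_comp_fst U V W (f : U -> W) (p : U * V) :
  differentiable f p.1 -> differentiable (fun y => f y.1) p.
Proof. by move=> df; exact: differentiable_comp (differentiable_fst p) df. Qed.

Lemma differentiable_coord_comp V m n (f : V -> 'M[R]_(m, n)) i j x :
  differentiable f x -> differentiable (fun y => f y i j) x.
Proof.
move=> df; have := differentiable_comp df (differentiable_coord (f x) i j).
exact.
Qed.

Lemma derive_coord V m n (f : V -> 'M[R]_(m, n)) i j x v :
  derivable f x v -> 'D_v (fun y => f y i j) x = 'D_v f x i j.
Proof. by move=> df; rewrite (derive_mx df) mxE. Qed.

Lemma differentiable_big_prod V (I : finType) (f : I -> V -> R) x :
  (forall i, differentiable (f i) x) ->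
  differentiable (fun y => \prod_i f i y) x.
Proof.
move=> df; have -> : (fun y => \prod_i f i y) = \prod_i f i.
  by apply/funext => y; rewrite fct_prodE.
elim/big_ind : _ => [|g h dg dh|i _]; last exact: df.
  exact: differentiable_cst.
exact: differentiableM.
Qed.

Lemma differentiable_big_sum V W (I : finType) (f : I -> V -> W) x :
  (forall i, differentiable (f i) x) ->
  differentiable (fun y => \sum_i f i y) x.
Proof.
move=> df; have -> : (fun y => \sum_i f i y) = \sum_i f i.
  by apply/funext => y; rewrite fct_sumE.
elim/big_ind : _ => [|g h dg dh|i _]; last exact: df.
  exact: differentiable_cst.
exact: differentiableD.
Qed.

Lemma derive_big_sum V W n (f : 'I_n -> V -> W) x v :
  (forall i, derivable (f i) x v) ->
  'D_v (fun y => \sum_i f i y) x = \sum_i 'D_v (f i) x.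
Proof.
move=> df; rewrite -derive_sum//; congr (derive _ x v).
by apply/funext => y; rewrite fct_sumE.
Qed.

Lemma deriveM_fun V (f g : V -> R) x v :
  derivable f x v -> derivable g x v ->
  'D_v (fun y => f y * g y) x = f x * 'D_v g x + g x * 'D_v f x.
Proof. exact: deriveM. Qed.

Lemma deriveB_fun V W (f g : V -> W) x v :
  derivable f x v -> derivable g x v ->
  'D_v (fun y => f y - g y) x = 'D_v f x - 'D_v g x.
Proof. exact: deriveB. Qed.

Lemma differentiable_det V n (f : V -> 'M[R]_n) x :
  (forall i j, differentiable (fun y => f y i j) x) ->
  differentiable (fun y => \det (f y)) x.
Proof.
move=> df; apply: differentiable_big_sum => s.
apply: differentiableM; first exact: differentiable_cst.
by apply: differentiable_big_prod.
Qed.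

(** Cramer's rule writes each entry as a cofactor divided by the determinant. It describes [invmx]
    only at invertible matrices (elsewhere [invmx] returns its argument), hence the invertibility on
    a whole neighbourhood. *)
Lemma differentiable_invmx V n (f : V -> 'M[R]_n) x i j :
  (forall i j, differentiable (fun y => f y i j) x) ->
  (\forall y \near x, f y \in unitmx) ->
  differentiable (fun y => invmx (f y) i j) x.
Proof.
move=> df uf; have fx : f x \in unitmx by exact: nbhs_singleton uf.
apply: (@near_eq_differentiable _ _ (fun y => (\det (f y))^-1 * cofactor (f y) j i)).
  by near=> y; rewrite /invmx (near uf y)// !mxE.
apply: differentiableM.
  by apply: differentiableV; [exact: differentiable_det|rewrite -unitfE -unitmxE].
apply: differentiableM; first exact: differentiable_cst.
apply: differentiable_det => a b; under eq_fun do rewrite !mxE.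
exact: df.
Unshelve. all: by end_near. Qed.

End calculus.

(** * Frames and coframes *)

Lemma smooth_differentiable (R : realType) (V W : normedModType R) (U : set V)
  (f : V -> W) x : smooth U f -> U x -> differentiable f x.
Proof. by move=> /(_ 1%N)[df _] /df. Qed.

Section coframe.
Context {R : realType} {n : nat} (X : 'I_n -> 'rV[R]_n -> 'rV[R]_n).
Implicit Types (q u e : 'rV[R]_n) (V : normedModType R).

Lemma coframe_row q u : frame_mx X q \in unitmx ->
  \sum_i coframe X i q u *: X i q = u.
Proof.
move=> uq; rewrite -[RHS](mulmxKV uq) mulmx_sum_row; apply: eq_bigr => i _.
by congr (_ *: _); apply/rowP => j; rewrite !mxE.
Qed.

Lemma coframe_frame q i j : frame_mx X q \in unitmx ->
  coframe X i q (X j q) = (i == j)%:R.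
Proof.
move=> uq; have -> : X j q = row j (frame_mx X q).
  by apply/rowP => l; rewrite !mxE.
by rewrite /coframe -row_mul mulmxV// !mxE eq_sym.
Qed.

Lemma coframeB i q u e : coframe X i q (u - e) = coframe X i q u - coframe X i q e.
Proof. by rewrite /coframe mulmxBl !mxE. Qed.

Lemma coframe_sum i q (I : finType) (c : I -> R) (v : I -> 'rV[R]_n) :
  coframe X i q (\sum_j c j *: v j) = \sum_j c j * coframe X i q (v j).
Proof.
rewrite /coframe mulmx_suml summxE; apply: eq_bigr => j _.
by rewrite -scalemxAl mxE.
Qed.

Lemma coframeE i q u :
  coframe X i q u = \sum_j u 0 j * invmx (frame_mx X q) j i.
Proof. by rewrite /coframe mxE. Qed.

Variables (Q : set 'rV[R]_n).
Hypotheses (oQ : open Q) (Xs : forall i, smooth Q (X i))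
  (Xu : forall q, Q q -> frame_mx X q \in unitmx).

Lemma differentiable_invframe q i j : Q q ->
  differentiable (fun q => invmx (frame_mx X q) i j) q.
Proof.
move=> Qq; apply: differentiable_invmx.
  move=> a b; under eq_fun do rewrite mxE.
  exact/differentiable_coord_comp/smooth_differentiable/Qq.
by apply: filterS Xu _; exact: open_nbhs_nbhs.
Qed.

Lemma differentiable_coframe V (f g : V -> 'rV[R]_n) i x :
  Q (g x) -> differentiable f x -> differentiable g x ->
  differentiable (fun y => coframe X i (g y) (f y)) x.
Proof.
move=> Qx df dg; under eq_fun do rewrite coframeE.
apply: differentiable_big_sum => j; apply: differentiableM.
  exact: differentiable_coord_comp.
have := differentiable_comp dg (differentiable_invframe j i Qx); exact.
Qed.

Lemma differentiable_coframel q i u : Q q ->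
  differentiable (fun q => coframe X i q u) q.
Proof.
move=> Qq; have := @differentiable_coframe _ (cst u) id i q Qq.
by apply; [exact: differentiable_cst|exact: ex_diff].
Qed.

Lemma derive_coframel q e i u : Q q ->
  'D_e (fun q => coframe X i q u) q =
  \sum_j u 0 j * 'D_e (fun q => invmx (frame_mx X q) j i) q.
Proof.
move=> Qq; under eq_fun do rewrite coframeE.
have dinv j : derivable (fun q => invmx (frame_mx X q) j i) q e.
  exact/diff_derivable/differentiable_invframe.
rewrite derive_big_sum; last by move=> j; exact: derivableM.
apply: eq_bigr => j _.
by rewrite (deriveM_fun (derivable_cst (u 0 j) _ _) (dinv j)) derive_cst mulr0 addr0.
Qed.

Lemma derive_coframel_sum q e i (I : finType) (c : I -> R) (v : I -> 'rV[R]_n) :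
  Q q ->
  'D_e (fun q => coframe X i q (\sum_j c j *: v j)) q =
  \sum_j c j * 'D_e (fun q => coframe X i q (v j)) q.
Proof.
move=> Qq; rewrite derive_coframel//.
under [RHS]eq_bigr do rewrite derive_coframel// mulr_sumr.
rewrite exchange_big; apply: eq_bigr => l _; rewrite summxE mulr_suml.
by apply: eq_bigr => j _; rewrite mxE mulrA.
Qed.

Lemma derive_coframe V (f g : V -> 'rV[R]_n) i x v :
  Q (g x) -> differentiable f x -> differentiable g x ->
  'D_v (fun y => coframe X i (g y) (f y)) x =
  'D_('D_v g x) (fun q => coframe X i q (f x)) (g x)
  + coframe X i (g x) ('D_v f x).
Proof.
move=> Qx df dg; rewrite derive_coframel// coframeE -big_split/=.
under eq_fun do rewrite coframeE.
have dinv j : differentiable (fun q => invmx (frame_mx X q) j i) (g x).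
  exact: differentiable_invframe.
have dfj j : differentiable (fun y => f y 0 j) x.
  exact: differentiable_coord_comp.
have dgj j : differentiable (fun y => invmx (frame_mx X (g y)) j i) x.
  have := differentiable_comp dg (dinv j); exact.
rewrite derive_big_sum; last first.
  by move=> j; apply/diff_derivable/differentiableM.
apply: eq_bigr => j _.
rewrite (deriveM_fun (diff_derivable (dfj j)) (diff_derivable (dgj j))).
rewrite (derive_coord _ _ (diff_derivable df)) [_ * 'D_v f x _ _]mulrC.
by rewrite -(derive_comp v dg (dinv j)).
Qed.

(** Differentiate the duality $\theta^i(X_j)=\delta^i_j$, which is constant near [q]: the variation
    of the coframe cancels that of the frame. *)
Lemma derive_coframe_frame q e i j : Q q ->
  'D_e (fun q' => coframe X i q' (X j q)) q = - coframe X i q ('D_e (X j) q).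
Proof.
move=> Qq; have dX : differentiable (X j) q by exact: smooth_differentiable Qq.
have dI : differentiable (@id 'rV[R]_n) q by exact: ex_diff.
have := @derive_coframe _ (X j) id i q e Qq dX dI.
rewrite derive_id => E; apply/eqP; rewrite -addr_eq0 -E; apply/eqP.
rewrite -(derive_cst ((i == j)%:R : R) q e); apply: near_eq_derive.
apply: (@filterS _ _ _ Q); last exact: open_nbhs_nbhs.
by move=> q' Qq'; rewrite /= coframe_frame// Xu.
Qed.

Lemma derive_coframe_expand q u e i : Q q ->
  'D_u (fun q' => coframe X i q' e) q =
  - \sum_j \sum_l coframe X j q e * coframe X l q u
      * coframe X i q ('D_(X l q) (X j) q).
Proof.
move=> Qq; rewrite -{1}(coframe_row e (Xu Qq)) derive_coframel_sum// -sumrN.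
apply: eq_bigr => j _; rewrite derive_coframe_frame// mulrN; congr (- _).
have dX : differentiable (X j) q by exact: smooth_differentiable Qq.
rewrite -{1}(coframe_row u (Xu Qq)) (derive_sumv _ dX).
under eq_bigr do rewrite (deriveZv _ _ dX).
by rewrite coframe_sum mulr_sumr; apply: eq_bigr => l _; rewrite mulrA.
Qed.

(** On frame fields this is $d\theta^i(X_l,X_j)=-\theta^i([X_l,X_j])=R^i_{jl}$. Both derivatives of
    the coframe are first moved onto the frame; swapping the summation indices in one of them pairs
    $D_{X_j}X_l$ with $D_{X_l}X_j$ into a bracket. *)
Lemma cartan_structure q u e i : Q q ->
  'D_u (fun q' => coframe X i q' e) q - 'D_e (fun q' => coframe X i q' u) q =
  \sum_j \sum_l coframe X j q e * coframe X l q u * frame_coef X i j l q.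
Proof.
move=> Qq; rewrite !derive_coframe_expand// opprK addrC.
rewrite exchange_big -sumrB; apply: eq_bigr => j _; rewrite -sumrB.
apply: eq_bigr => l _; rewrite /frame_coef /lie_bracket coframeB mulrBr.
by rewrite [coframe X l q u * _]mulrC.
Qed.

End coframe.

(** * Momenta and energy *)

Lemma vertical_sum (R : realType) (n : nat) (I : finType) (c : I -> R)
  (v : I -> 'rV[R]_n) :
  ((0 : 'rV[R]_n), \sum_i c i *: v i) = \sum_i c i *: ((0 : 'rV[R]_n), v i).
Proof.
rewrite [RHS]surjective_pairing !(raddf_sum fst, raddf_sum snd)/=.
by congr pair; rewrite big1// => i _; rewrite scaler0.
Qed.

Lemma horizontal_sum (R : realType) (n : nat) (I : finType) (c : I -> R)
  (v : I -> 'rV[R]_n) :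
  (\sum_i c i *: v i, (0 : 'rV[R]_n)) = \sum_i c i *: (v i, (0 : 'rV[R]_n)).
Proof.
rewrite [RHS]surjective_pairing !(raddf_sum fst, raddf_sum snd)/=.
by congr pair; rewrite big1// => i _; rewrite scaler0.
Qed.

Section momentum.
Context {R : realType} {n : nat} (X : 'I_n -> 'rV[R]_n -> 'rV[R]_n).
Variables (Q : set 'rV[R]_n) (L : 'rV[R]_n * 'rV[R]_n -> R).
Hypotheses (oQ : open Q) (Xs : forall i, smooth Q (X i))
  (Xu : forall q, Q q -> frame_mx X q \in unitmx)
  (Ls : smooth (tangent_bundle Q) L).
Implicit Types w : 'rV[R]_n * 'rV[R]_n.

Lemma open_tangent_bundle : open (tangent_bundle Q).
Proof. by apply: (open_comp (f := fst)) oQ => w _; exact: cvg_fst. Qed.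

Lemma differentiable_lagrangian w : Q w.1 -> differentiable L w.
Proof. by move=> Qw; exact: smooth_differentiable Ls Qw. Qed.

Lemma coframe_momentum w u : Q w.1 ->
  \sum_i coframe X i w.1 u * momentum X L i w = 'D_(0, u) L w.
Proof.
move=> Qw; have dL := differentiable_lagrangian Qw.
rewrite -{2}(coframe_row u (Xu Qw)) vertical_sum (derive_sumv _ dL).
by apply: eq_bigr => i _; rewrite (deriveZv _ _ dL).
Qed.

(** The direction of differentiation moves with the point, so smoothness of [L] does not apply
    directly. Over the open set [Q] the momentum is a combination of derivatives of [L] in fixed
    coordinate directions, with the components of [X i] as coefficients. *)
Lemma differentiable_momentum i w : Q w.1 -> differentiable (momentum X L i) w.
Proof.
move=> Qw; apply: (@near_eq_differentiable _ _ _
  (fun y => \sum_j X i y.1 0 j * 'D_(0, delta_mx 0 j) L y)).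
  apply: (@filterS _ _ _ (tangent_bundle Q)); last first.
    by apply: open_nbhs_nbhs; split => //; exact: open_tangent_bundle.
  move=> y Qy; have dL := differentiable_lagrangian Qy.
  rewrite /momentum /lie_derive /vertical_lift [X in (0, X)]row_sum_delta.
  rewrite vertical_sum (derive_sumv _ dL).
  by apply: eq_bigr => j _; rewrite (deriveZv _ _ dL).
apply: differentiable_big_sum => j; apply: differentiableM.
  apply: differentiable_coord_comp.
  apply: (@differentiable_comp_fst _ _ _ _ (X i)).
  exact: smooth_differentiable Qw.
by have [_ /(_ (0, delta_mx 0 j))[dL _]] := Ls 2%N; exact: dL.
Qed.

Lemma differentiable_quasi_velocity i w : Q w.1 ->
  differentiable (quasi_velocity X i) w.
Proof.
move=> Qw.
exact: (differentiable_coframe oQ Xs Xu i Qw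
  (differentiable_snd w) (differentiable_fst w)).
Qed.

Lemma differentiable_energy w : Q w.1 -> differentiable (energy X L) w.
Proof.
move=> Qw; apply: differentiableB; last exact: differentiable_lagrangian.
apply: differentiable_big_sum => i.
apply: differentiableM; last exact: differentiable_momentum.
exact: differentiable_quasi_velocity.
Qed.

Lemma derive_energy w v : Q w.1 ->
  'D_v (energy X L) w =
  \sum_i (('D_(v.1) (fun q => coframe X i q w.2) w.1 + coframe X i w.1 v.2)
            * momentum X L i w
          + coframe X i w.1 w.2 * 'D_v (momentum X L i) w)
  - 'D_v L w.
Proof.
move=> Qw; have dL := differentiable_lagrangian Qw.
have dM i := differentiable_momentum i Qw.
have dq i := differentiable_quasi_velocity i Qw.
rewrite [LHS]deriveB_fun; last exact: diff_derivable; last first.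
  apply/diff_derivable/differentiable_big_sum => i; exact: differentiableM.
rewrite derive_big_sum; last first.
  by move=> i; apply/diff_derivable/differentiableM.
congr (_ - _); apply: eq_bigr => i _.
rewrite (deriveM_fun (diff_derivable (dq i)) (diff_derivable (dM i))).
rewrite addrC; congr (_ + _); rewrite mulrC; congr (_ * _).
rewrite [LHS](derive_coframe oQ Xs Xu i v Qw
  (differentiable_snd w) (differentiable_fst w)).
by rewrite derive_fst derive_snd.
Qed.

End momentum.

(** * The vakonomic equations *)

(** The algebra behind [vakonomic_residualP]. With $\eta=(h_q,h_u,h_\mu)$: [t1], [t2], [t3] are
    $\theta(h_q)$, $\theta(u)$, $\theta(h_u)$; [M] is the momentum, with derivatives [dM1], [dM2]
    along $\xi$ and $\eta$; [N1], [N2], [N3] are the extended multipliers of $\xi$, of $\eta$ and of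
    the point; [T1], [T2] are $D_u\theta(h_q)$, $D_{h_q}\theta(u)$. [A] and [B] are the horizontal
    and fibre parts of $X_j^{\mathrm C}(L)$, [C] is the bracket term, and [D] is $D_\eta L$ with
    fibre part [D0]. *)
Lemma sum_regroup (R : comPzRingType) (n : nat)
  (M dM1 dM2 N1 N2 N3 t1 t2 t3 T1 T2 A B C : 'I_n -> R) (D D0 : R) :
  \sum_i t3 i * M i = D0 ->
  \sum_i N2 i * t2 i = 0 ->
  \sum_i M i * T1 i = - \sum_i t1 i * B i ->
  \sum_i N3 i * (T1 i - T2 i) = \sum_i t1 i * C i ->
  D = D0 + \sum_i t1 i * A i ->
  \sum_i ((dM1 i - N1 i) * t1 i + (M i - N3 i) * T1 i)
  - \sum_i ((dM2 i - N2 i) * t2 i + (M i - N3 i) * T2 i)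
  + (\sum_i ((T2 i + t3 i) * M i + t2 i * dM2 i) - D)
  = \sum_i t1 i * (dM1 i - (A i + B i) - N1 i - C i).
Proof.
move=> <- H2 H3 H4 ->; apply/eqP; rewrite -subr_eq0; apply/eqP.
(* The terms [t2 i * dM2 i] and [M i * T2 i] cancel. The difference of the two sides is then the sum
   of the discrepancies in [H2], [H3] and [H4], each of which is zero. *)
transitivity (\sum_i N2 i * t2 i + \sum_i (t1 i * B i + M i * T1 i
    + (t1 i * C i - N3 i * (T1 i - T2 i)))); last first.
  by rewrite H2 !big_split/= sumrN H3 H4 !subrr !addr0.
rewrite !opprD !addrA -!sumrN -!big_split/=.
by apply: eq_bigr => i _; ring.
Qed.

Section vakonomic.
Context {R : realType} {m k : nat}.
Variables (X : 'I_(m + k) -> 'rV[R]_(m + k) -> 'rV[R]_(m + k)).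
Variables (Q : set 'rV[R]_(m + k)) (L : 'rV[R]_(m + k) * 'rV[R]_(m + k) -> R).
Hypotheses (oQ : open Q) (Xs : forall i, smooth Q (X i))
  (Xu : forall q, Q q -> frame_mx X q \in unitmx)
  (Ls : smooth (tangent_bundle Q) L).
Implicit Types (w : 'rV[R]_(m + k) * 'rV[R]_(m + k)) (mu : 'rV[R]_k)
  (p xi eta : 'rV[R]_(m + k) * 'rV[R]_(m + k) * 'rV[R]_k).

(* mu_i theta^i over all frame indices, with mu_alpha = 0. *)
Definition extend_multiplier mu : 'rV[R]_(m + k) := row_mx 0 mu.

Lemma extend_multiplierl mu al : extend_multiplier mu 0 (lshift k al) = 0.
Proof. by rewrite /extend_multiplier row_mxEl mxE. Qed.

Lemma extend_multiplierr mu a : extend_multiplier mu 0 (rshift m a) = mu 0 a.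
Proof. by rewrite /extend_multiplier row_mxEr. Qed.

Lemma sum_extend_multiplier mu (f : 'I_(m + k) -> R) :
  \sum_i extend_multiplier mu 0 i * f i = \sum_a mu 0 a * f (rshift m a).
Proof.
rewrite big_split_ord/= big1 ?add0r; last first.
  by move=> al _; rewrite extend_multiplierl mul0r.
by apply: eq_bigr => a _; rewrite extend_multiplierr.
Qed.

Lemma derive_extend_multiplier p v i :
  is_derive p v (fun y => extend_multiplier y.2 0 i) (extend_multiplier v.2 0 i).
Proof.
case: (splitP i) => [al ial|a ia].
  have -> : i = lshift k al by exact: val_inj.
  by under eq_fun do rewrite extend_multiplierl; rewrite extend_multiplierl;
    exact: is_derive_cst.
have -> : i = rshift m a by exact: val_inj.
under eq_fun do rewrite extend_multiplierr; rewrite extend_multiplierr.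
have ds := differentiable_snd p.
apply: DeriveDef; first exact/diff_derivable/differentiable_coord_comp.
by rewrite (derive_coord _ _ (diff_derivable ds)) derive_snd.
Qed.

Lemma vakonomic_formE p eta :
  vakonomic_form X L p eta =
  \sum_i (momentum X L i p.1 - extend_multiplier p.2 0 i)
         * coframe X i p.1.1 eta.1.1.
Proof.
rewrite /vakonomic_form.
rewrite -(sum_extend_multiplier _ (fun i => coframe X i p.1.1 eta.1.1)).
by rewrite -sumrB; apply: eq_bigr => i _; rewrite mulrBl.
Qed.

Lemma derive_vakonomic_form p xi eta : Q p.1.1 ->
  'D_xi (fun y => vakonomic_form X L y eta) p =
  \sum_i (('D_(xi.1) (momentum X L i) p.1 - extend_multiplier xi.2 0 i)
            * coframe X i p.1.1 eta.1.1
          + (momentum X L i p.1 - extend_multiplier p.2 0 i)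
            * 'D_(xi.1.1) (fun q => coframe X i q eta.1.1) p.1.1).
Proof.
move=> Qp; under eq_fun do rewrite vakonomic_formE.
have dM i : differentiable (fun y => momentum X L i y.1) p.
  exact/differentiable_comp_fst/(differentiable_momentum oQ Xs Ls).
have dw i : differentiable (fun w => coframe X i w.1 eta.1.1) p.1.
  exact: (differentiable_comp_fst (differentiable_coframel oQ Xs Xu i _ Qp)).
have dt i : differentiable (fun y => coframe X i y.1.1 eta.1.1) p.
  exact: (differentiable_comp_fst (dw i)).
have dmu i := derive_extend_multiplier p xi i.
have dN i : derivable (fun y => momentum X L i y.1 - extend_multiplier y.2 0 i) p xi.
  by apply: derivableB; [exact: diff_derivable|exact: ex_derive].
rewrite derive_big_sum; last first.
  by move=> i; apply: derivableM => //; exact: diff_derivable.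
apply: eq_bigr => i _.
rewrite (deriveM_fun (dN i) (diff_derivable (dt i))) addrC mulrC; congr (_ * _ + _ * _).
  rewrite (deriveB_fun (diff_derivable (dM i)) ex_derive) derive_val.
  by rewrite (derive_comp_fst _ (differentiable_momentum oQ Xs Ls _ _)).
Qed.

Lemma derive_complete_lift j w : Q w.1 ->
  'D_(complete_lift (X j) w) L w =
  'D_(X j w.1, 0) L w + 'D_(0, 'D_(w.2) (X j) w.1) L w.
Proof.
move=> Qw; rewrite -(deriveDv _ _ (differentiable_lagrangian Ls Qw)).
by congr ('D_ _ L w); rewrite /complete_lift; congr pair; rewrite /= ?addr0 ?add0r.
Qed.

(** The coefficient of $\theta^j$ in $\xi\lrcorner\hat\omega+dE$ at a constrained point. Here [l]
    runs over all frame indices; the constraint removes the transverse ones later. *)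
Definition vakonomic_residual p xi (j : 'I_(m + k)) : R :=
  'D_(xi.1) (momentum X L j) p.1 - 'D_(complete_lift (X j) p.1) L p.1
  - extend_multiplier xi.2 0 j
  - \sum_i \sum_l extend_multiplier p.2 0 i * coframe X l p.1.1 p.1.2
                  * frame_coef X i j l p.1.1.

(** Second-order type makes $\theta(\xi)$ equal to $\theta(u)$, so the derivatives of the momenta
    along [eta] and the fibre directions of [eta] cancel against the energy. The constraint $v^a=0$
    cancels the multiplier directions. Only the base component of [eta] survives. *)
Lemma vakonomic_residualP p xi eta :
  Q p.1.1 -> xi.1.1 = p.1.2 ->
  (forall a : 'I_k, coframe X (rshift m a) p.1.1 p.1.2 = 0) ->
  ext_derive (vakonomic_form X L) p xi eta
  + 'D_eta (fun y => energy X L y.1) p =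
  \sum_j coframe X j p.1.1 eta.1.1 * vakonomic_residual p xi j.
Proof.
move: p xi eta => [[q u] mu] [[dq du] dmu] [[hq hu] hmu]/= Qq -> cu.
rewrite /ext_derive !derive_vakonomic_form//=.
have dL := differentiable_lagrangian Ls (w := (q, u)) Qq.
have dE : differentiable (energy X L) (q, u, mu).1.
  exact: (differentiable_energy oQ Xs Xu Ls).
rewrite (derive_comp_fst _ dE) (derive_energy oQ Xs Xu Ls)//=.
have H1 := coframe_momentum Xu Ls hu (w := (q, u)) Qq.
have H2 : \sum_i extend_multiplier hmu 0 i * coframe X i q u = 0.
  by rewrite sum_extend_multiplier big1// => a _; rewrite cu mulr0.
(* Duality moves the derivative from the coframe onto the frame; contracting with the momenta then
   gives the fibre derivative of [L] along $D_uX_j$, the fibre part of the complete lift. *)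
have H3 : \sum_i momentum X L i (q, u) * 'D_u (fun q' => coframe X i q' hq) q
    = - \sum_j coframe X j q hq * 'D_(0, 'D_u (X j) q) L (q, u).
  rewrite -sumrN.
  under [RHS]eq_bigr do
    rewrite -(coframe_momentum Xu Ls _ (w := (q, u)) Qq) mulr_sumr -sumrN.
  rewrite exchange_big; apply: eq_bigr => i _/=.
  rewrite -{1}(coframe_row hq (Xu Qq)) (derive_coframel_sum oQ Xs Xu)// mulr_sumr.
  apply: eq_bigr => j _; rewrite (derive_coframe_frame oQ Xs Xu)//.
  ring.
(* The multipliers meet the coframe only through its exterior derivative, so this is where the
   functions $R^i_{jl}$ enter. *)
have H4 : \sum_i extend_multiplier mu 0 i *
     ('D_u (fun q' => coframe X i q' hq) q - 'D_hq (fun q' => coframe X i q' u) q)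
   = \sum_j coframe X j q hq * (\sum_i \sum_l extend_multiplier mu 0 i * coframe X l q u
                  * frame_coef X i j l q).
  under [RHS]eq_bigr do rewrite mulr_sumr.
  rewrite exchange_big; apply: eq_bigr => i _/=.
  rewrite (cartan_structure oQ Xs Xu)// mulr_sumr; apply: eq_bigr => j _.
  rewrite !mulr_sumr; apply: eq_bigr => l _.
  ring.
have H5 : 'D_(hq, hu) L (q, u) = 'D_(0, hu) L (q, u)
    + \sum_j coframe X j q hq * 'D_(X j q, 0) L (q, u).
  transitivity ('D_(0, hu) L (q, u) + 'D_(hq, 0) L (q, u)).
    rewrite -(deriveDv _ _ dL); congr ('D_ _ L _).
    by congr pair; rewrite /= ?addr0 ?add0r.
  congr (_ + _); rewrite -{1}(coframe_row hq (Xu Qq)) horizontal_sum.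
  rewrite (derive_sumv _ dL); apply: eq_bigr => j _.
  by rewrite (deriveZv _ _ dL).
rewrite (sum_regroup _ _ _ H1 H2 H3 H4 H5); apply: eq_bigr => j _.
by rewrite /vakonomic_residual derive_complete_lift.
Qed.

End vakonomic.

(** * Smooth extensions and tangent vectors *)

Section smooth.
Context {R : realType} {V : normedModType R}.

(** Openness turns agreement on [U] into agreement near each of its points, so the directional
    derivatives agree on [U] too and the induction on [r] continues. *)
Lemma Cr_eq_on (W : normedModType R) (r : nat) (U : set V) (f g : V -> W) :
  open U -> (forall x, U x -> f x = g x) -> Cr r U f -> Cr r U g.
Proof.
move=> oU; elim: r f g => [|r IH] f g fg /=.
  move=> fc x Ux; have := fc x Ux; rewrite /prop_for /continuous_at fg// => fx.
  apply: cvg_trans fx; apply: near_eq_cvg.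
  by apply: (@filterS _ _ _ U) => //; exact: open_nbhs_nbhs.
have nfg x : U x -> {near x, f =1 g}.
  by move=> Ux; apply: (@filterS _ _ _ U) => //; exact: open_nbhs_nbhs.
move=> [df Df]; split=> [x Ux|v].
  exact: near_eq_differentiable (nfg x Ux) (df x Ux).
apply: IH (Df v) => x Ux; apply: near_eq_derive; exact: nfg.
Qed.

Lemma smooth_coord m n (U : set V) (f : V -> 'M[R]_(m, n)) i j :
  open U -> smooth U f -> smooth U (fun x => f x i j).
Proof.
move=> oU sf r; move: (sf r) => {sf}; elim: r f => [|r IH] f /=.
  move=> fc x Ux; have := continuous_comp (fc x Ux) (@coord_continuous _ _ _ i j (f x)).
  exact.
move=> [df Df]; split=> [x Ux|v]; first exact/differentiable_coord_comp/df.
apply: (Cr_eq_on oU _ (IH _ (Df v))) => x Ux.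
by rewrite derive_coord//; exact/diff_derivable/df.
Qed.

Lemma smooth_extension_coord m n (S : set V) (f F : V -> 'M[R]_(m, n)) x i j :
  smooth_extension_near S f x F ->
  smooth_extension_near S (fun y => f y i j) x (fun y => F y i j).
Proof.
move=> [N [oN Nx sF Ff]]; exists N; split=> //; first exact: smooth_coord.
by move=> y Oy Sy; rewrite Ff.
Qed.

(** Along a curve in [S] the functions [f] and [F] coincide, and the chain rule applies to [F]. As
    [f \o c] does not mention [F], the value ['D_xi F] is the same for all extensions. *)
Lemma is_derive_extension (W : normedModType R) (S : set V) (f F : V -> W)
  (c : R -> V) (xi : V) :
  (\forall t \near (0 : R), S (c t)) -> is_derive (0 : R) (1 : R) c xi ->
  smooth_extension_near S f (c 0) F ->
  is_derive (0 : R) (1 : R) (f \o c) ('D_xi F (c 0)).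
Proof.
move=> Sc [dc <-] [N [oN Nc sF Ff]].
have /derivable1_diffP dfc := dc.
have dF : differentiable F (c 0) by exact: smooth_differentiable Nc.
apply: (@near_eq_is_derive _ _ _ (F \o c)).
  have Nct : \forall t \near (0 : R), N (c t).
    apply: (differentiable_continuous dfc); exact: open_nbhs_nbhs.
  by apply: filterS2 Sc Nct => t St Ot; exact: Ff.
apply: DeriveDef; first exact/diff_derivable/differentiable_comp.
exact: derive_comp.
Qed.

Lemma derive_alongE (W : normedModType R) (S : set V) (f F : V -> W) (x xi : V) :
  tangent_to S x xi -> smooth_extension_near S f x F ->
  derive_along S f x xi = 'D_xi F x.
Proof.
move=> [c [cx Sc dc]] Fx; rewrite /derive_along; set P := (X in get X).
(* The given [F] shows that the set of candidate values is nonempty, so [get] returns the derivative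
   of some extension [G]; both [F] and [G] compute the velocity of [f \o c]. *)
have [G [Gx ->]] : P (get P) by apply: getPex; exists ('D_xi F x), F.
rewrite -cx in Fx Gx *.
have [_ <-] := is_derive_extension Sc dc Fx.
by have [_ <-] := is_derive_extension Sc dc Gx.
Qed.

Lemma is_derive_pair (U W : normedModType R) (c : R -> U) (d : R -> W) (t : R) u v :
  is_derive t (1 : R) c u -> is_derive t (1 : R) d v ->
  is_derive t (1 : R) (fun s => (c s, d s)) (u, v).
Proof.
move=> [/derivable1_diffP dc <-] [/derivable1_diffP dd <-].
have dcd := differentiable_pair dc dd.
apply: DeriveDef; first exact: diff_derivable.
by rewrite (deriveE _ dcd) (diff_pair dc dd) (deriveE _ dc) (deriveE _ dd).
Qed.

End smooth.

(** * The vakonomic equations at points of the constraint set *)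

Section consistency.
Context {R : realType} {m k : nat}.
Variables (Q : set 'rV[R]_(m + k)) (D : 'rV[R]_(m + k) -> {vspace 'rV[R]_(m + k)})
  (X : 'I_(m + k) -> 'rV[R]_(m + k) -> 'rV[R]_(m + k))
  (L : 'rV[R]_(m + k) * 'rV[R]_(m + k) -> R).
Hypotheses (oQ : open Q) (hX : adapted_frame Q D X)
  (Ls : smooth (tangent_bundle Q) L).
Implicit Types (w : 'rV[R]_(m + k) * 'rV[R]_(m + k)).

(** Such a velocity is a combination of the fields $X_\alpha$, all annihilated by $\theta^a$. *)
Lemma constraint_coframe w a :
  constraint_set Q D w -> coframe X (rshift m a) w.1 w.2 = 0.
Proof.
have [_ Xu XD] := hX; move=> [Qw]; rewrite (XD _ Qw).
set s := [seq _ | al : 'I_m] => ws; rewrite (coord_span (X := in_tuple s) ws).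
rewrite coframe_sum big1// => i _.
have /mapP[al _ ->] : (in_tuple s)`_i \in s by exact: mem_nth.
by rewrite coframe_frame ?Xu// eq_rlshift mulr0.
Qed.

Lemma vakonomic_eqP w mu (xi : 'rV[R]_(m + k) * 'rV[R]_(m + k) * 'rV[R]_k) :
  constraint_set Q D w -> xi.1.1 = w.2 ->
  vakonomic_eq X L (w, mu) xi <-> forall j, vakonomic_residual X L (w, mu) xi j = 0.
Proof.
have [Xs Xu XD] := hX; move=> Cw xiw; have [Qw _] := Cw.
have cw a : coframe X (rshift m a) w.1 w.2 = 0 by exact: constraint_coframe.
have E eta := vakonomic_residualP oQ Xs Xu Ls eta
  (p := (w, mu)) (xi := xi) Qw xiw cw.
split=> [H j|H eta]; last first.
  by apply/eqP; rewrite -addr_eq0 E big1// => j _; rewrite H mulr0.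
(* The horizontal test vector along $X_j$ isolates the [j]-th residual by duality. *)
have := E ((X j w.1, 0), 0); rewrite H addNr (bigD1 j)//= big1; last first.
  by move=> i ij; rewrite coframe_frame ?Xu// (negbTE ij) mul0r.
by rewrite coframe_frame ?Xu// eqxx mul1r addr0.
Qed.

(** The extended multipliers vanish on the indices of the distribution and the quasi-velocities on
    the transverse ones, so the double sum shrinks to pairs [a], [be]. *)
Lemma vakonomic_residualE w mu xi Gamma j :
  constraint_set Q D w -> xi.1 = Gamma w ->
  vakonomic_residual X L (w, mu) xi j =
  euler_lagrange X L Gamma j w - extend_multiplier xi.2 0 j
  - \sum_(a < k) \sum_(be < m)
      mu 0 a * frame_coef X (rshift m a) j (lshift k be) w.1
      * quasi_velocity X (lshift k be) w.
Proof.
move=> Cw xiG; rewrite /vakonomic_residual /euler_lagrange /lie_derive xiG/=.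
congr (_ - _).
under eq_bigr do under eq_bigr do rewrite -mulrA.
under eq_bigr do rewrite -mulr_sumr.
rewrite sum_extend_multiplier; apply: eq_bigr => a _.
rewrite mulr_sumr big_split_ord/= [X in _ + X]big1 ?addr0; last first.
  by move=> b _; rewrite constraint_coframe// mul0r mulr0.
by apply: eq_bigr => be _; rewrite [coframe _ _ _ _ * _]mulrC mulrA.
Qed.

End consistency.
Theorem corollary1 (R : realType) (m k : nat)
  (Q : set 'rV[R]_(m + k)) (hQ : open Q)
  (D : 'rV[R]_(m + k) -> {vspace 'rV[R]_(m + k)})
  (hD : ~ integrable_distribution m Q D)
  (X : 'I_(m + k) -> 'rV[R]_(m + k) -> 'rV[R]_(m + k))
  (hX : adapted_frame Q D X)
  (L : 'rV[R]_(m + k) * 'rV[R]_(m + k) -> R)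
  (hL : smooth (tangent_bundle Q) L)
  (hreg : regular_lagrangian Q X L)
  (hregD : regular_wrt_D Q D X L)
  (hregDperp : regular_wrt_Dperp Q D X L)
  (Gamma : 'rV[R]_(m + k) * 'rV[R]_(m + k) -> 'rV[R]_(m + k) * 'rV[R]_(m + k))
  (hGamma : nonholonomic_dynamics Q D X L Gamma) :
  strongly_consistent Q D X L Gamma <->
  exists phi : 'rV[R]_(m + k) * 'rV[R]_(m + k) -> 'rV[R]_k,
    smooth_on_subset (constraint_set Q D) phi /\
    forall w, constraint_set Q D w ->
      (forall al : 'I_m,
         \sum_(a < k) \sum_(be < m)
           phi w 0 a
           * frame_coef X (rshift m a) (lshift k al) (lshift k be) w.1
           * quasi_velocity X (lshift k be) w = 0) /\
      (forall a : 'I_k,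
         derive_along (constraint_set Q D) (fun w' => phi w' 0 a) w (Gamma w)
         + \sum_(b < k) \sum_(al < m)
             phi w 0 b
             * frame_coef X (rshift m b) (rshift m a) (lshift k al) w.1
             * quasi_velocity X (lshift k al) w
         = multiplier X L Gamma a w).
Proof.
have [Xs Xu XD] := hX.
split=> [[phi [hG [sphi [vG GG] tG]]]|[phi [sphi H]]].
  exists phi; split=> // w Cw.
  have pC : section_image Q D phi (w, phi w) by [].
  have [hw tw elw] := hGamma w Cw.
  have [veq _] := vG _ pC; have xiG : (hG (w, phi w)).1 = Gamma w := GG _ pC.
  have xiw : (hG (w, phi w)).1.1 = w.2 by rewrite xiG.
  move/(vakonomic_eqP hQ hX hL _ Cw xiw) : veq => res.
  split=> [al|a].
    (* Here the Euler-Lagrange term vanishes by the nonholonomic equations and the multiplier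
       velocity has no such component, which leaves the algebraic condition. *)
    have := res (lshift k al).
    rewrite (vakonomic_residualE _ hX _ _ Cw xiG) elw extend_multiplierl.
    by rewrite subrr sub0r => /eqP; rewrite oppr_eq0 => /eqP.
  have := res (rshift m a).
  rewrite (vakonomic_residualE _ hX _ _ Cw xiG) extend_multiplierr.
  (* The residual already prescribes the multiplier velocity of [hG]; tangency to the image of [phi]
     has to identify it with $\Gamma(\phi_a)$. *)
  suff -> : derive_along (constraint_set Q D) (fun w' => phi w' 0 a) w (Gamma w)
      = (hG (w, phi w)).2 0 a.
    by move/eqP; rewrite subr_eq0 subr_eq addrC => /eqP <-.
  have [F Fw] := sphi w Cw.
  have Fa := smooth_extension_coord 0 a Fw.
  rewrite (derive_alongE tw Fa).
  (* A curve in the image of [phi] with velocity [hG]: its projection to the constraint set has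
     velocity [Gamma w], and its multiplier part is [phi] of that projection. *)
  have [c [c0 cS [dc xiE]]] := tG _ pC.
  have /derivable1_diffP dfc := dc.
  have c10 : (c 0).1 = w by rewrite c0.
  have dc1 : is_derive (0 : R) (1 : R) (fst \o c) (Gamma w).
    apply: DeriveDef.
      exact/diff_derivable/differentiable_comp/differentiable_fst.
    by rewrite (derive_comp _ dfc (differentiable_fst _)) derive_fst xiE.
  have Sc1 : \forall t \near (0 : R), constraint_set Q D ((fst \o c) t).
    by apply: filterS cS => t [].
  have Fa' : smooth_extension_near (constraint_set Q D) (fun y => phi y 0 a)
      ((fst \o c) 0) (fun y => F y 0 a) by rewrite /= c10.
  have [_ /=] := is_derive_extension Sc1 dc1 Fa'.
  rewrite c10 => <-.
  (* Near 0 the curve stays in the image of [phi], so [phi] along the projected curve is its last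
     component. *)
  transitivity ('D_1 (fun t => (c t).2 0 a) (0 : R)).
    by apply: near_eq_derive; apply: filterS cS => t [_ /= ->].
  have ds : differentiable (snd \o c) (0 : R).
    exact: differentiable_comp dfc (differentiable_snd _).
  rewrite (derive_coord (f := snd \o c) 0 a (diff_derivable ds)).
  by rewrite (derive_comp _ dfc (differentiable_snd _)) derive_snd xiE.
pose S := constraint_set Q D.
(* Taking $\Gamma(\phi_a)$ as multiplier velocity makes the field the push-forward of [Gamma] by the
   section. The differential condition on [phi] is then what yields the vakonomic equations in the
   transverse indices. *)
pose mudot w := \row_a derive_along S (fun w' => phi w' 0 a) w (Gamma w).
exists phi, (fun p => (Gamma p.1, mudot p.1)); split => //.
  split=> // -[w mu] [/= Cw muw]; split; last by have [] := hGamma w Cw.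
  have [hw tw elw] := hGamma w Cw; have [H1 H2] := H w Cw.
  apply/(vakonomic_eqP hQ hX hL _ Cw) => // j.
  rewrite (vakonomic_residualE _ hX _ _ Cw (Gamma := Gamma))// muw.
  case: (splitP j) => [al jal|a ja].
    have -> : j = lshift k al by exact: val_inj.
    by rewrite elw extend_multiplierl H1 !subr0.
  have -> : j = rshift m a by exact: val_inj.
  rewrite extend_multiplierr mxE -[euler_lagrange _ _ _ _ _]H2 /S.
  by rewrite -addrA -opprD subrr.
move=> [w mu] [/= Cw muw].
have [hw tw elw] := hGamma w Cw; have [c [c0 cS dc]] := tw.
have [F Fw] := sphi w Cw.
(* Tangency is witnessed by the lift through [phi] of a curve in the constraint set with velocity
   [Gamma w]. *)
exists (fun t => (c t, phi (c t))); split.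
- by rewrite c0 muw.
- by apply: filterS cS => t.
(* The entries of [mudot] are defined through separate [derive_along] choices; the coordinates of
   the single extension [F] compute all of them at once. *)
have -> : mudot w = 'D_(Gamma w) F w.
  apply/rowP => a; rewrite mxE.
  rewrite (derive_alongE tw (smooth_extension_coord 0 a Fw)) derive_coord//.
  apply: diff_derivable; have [N [oN Nw sF _]] := Fw.
  exact: smooth_differentiable Nw.
have Fc : smooth_extension_near S phi (c 0) F by rewrite c0.
have := is_derive_extension cS dc Fc; rewrite c0 => dphi.
exact: is_derive_pair dc dphi.
Qed.
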